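(* Let $(\mathbb{X},\mathbb{0},\mathbb{1},\oplus,\otimes)$ be a linearly ordered radicable idempotent semifield and let $n\geq 1$ be an integer. Let $\bm{B}\in\mathbb{X}^{n\times n}$ be a matrix with $\mathrm{Tr}(\bm{B})\leq\mathbb{1}$. Let $\bm{g}\in\mathbb{X}^{n}$ be a vector and $\bm{h}\in\mathbb{X}^{n}$ a regular vector such that $\bm{h}^{-}\bm{B}^{\ast}\bm{g}\leq\mathbb{1}$. Let $\bm{p},\bm{q}\in\mathbb{X}^{n}$ be nonzero vectors such that $\bm{q}^{-}\bm{p}>\mathbb{0}$. Consider the problem of minimizing $$\bm{x}^{-}\bm{p}\,\bm{q}^{-}\bm{x}$$ over all regular vectors $\bm{x}\in\mathbb{X}^{n}$ subject to $\bm{B}\bm{x}\leq\bm{x}$ and $\bm{g}\leq\bm{x}\leq\bm{h}$. Then the minimum value of the objective function in this problem is equal to $$\theta=\bigoplus_{0\leq i+j\leq n-2}(\bm{h}^{-}\bm{B}^{i}\bm{p})(\bm{q}^{-}\bm{B}^{j}\bm{g})\oplus\bm{q}^{-}\bm{B}^{\ast}\bm{p},$$ and all regular solutions are given in the parametric form $$\bm{x}=\bm{G}\bm{u},\qquad \bm{G}=\bigoplus_{0\leq i+j\leq n-2}\theta^{-1}\bm{B}^{i}\bm{p}\,\bm{q}^{-}\bm{B}^{j}\oplus\bm{B}^{\ast},$$ where $\bm{u}\in\mathbb{X}^{n}$, $\bm{u}\neq\bm{0}$, is a vector of parameters satisfying $$\bm{g}\leq\bm{u}\leq(\bm{h}^{-}\bm{G})^{-}.$$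 That is, a regular vector $\bm{x}$ is feasible and attains the minimum $\theta$ if and only if $\bm{x}=\bm{G}\bm{u}$ for some such $\bm{u}$.
   Context: Idempotent semifield: $\mathbb{X}$ is a set with distinct elements $\mathbb{0}$ (zero) and $\mathbb{1}$ (one), closed under $\oplus$ and $\otimes$, such that $(\mathbb{X},\mathbb{0},\oplus)$ is a commutative idempotent monoid ($x\oplus x=x$), $(\mathbb{X}\setminus\{\mathbb{0}\},\mathbb{1},\otimes)$ is an Abelian group, $\otimes$ distributes over $\oplus$, and $\mathbb{0}$ is absorbing for $\otimes$. The sign $\otimes$ is omitted. The order is $x\leq y\iff x\oplus y=y$; ''linearly ordered'' means this order is total. ''Radicable'' means that for every $a\in\mathbb{X}$ and integer $p>0$ the equation $x^{p}=a$ has a unique solution $x\in\mathbb{X}$. Matrix and vector operations are the usual ones with $+,\times$ replaced by $\oplus,\otimes$; inequalities between vectors are entrywise. $\mathbb{X}^{n}$ denotes column vectors. $\bm{0}$ is the vector with all entries $\mathbb{0}$; a vector is nonzero if it differs from $\bm{0}$, and regular if none of its entries is $\mathbb{0}$. For a nonzero column vector $\bm{x}=(x_i)$, $\bm{x}^{-}$ is the row vector with entries $x_i^{-1}$ if $x_i\neq\mathbb{0}$ and $\mathbb{0}$ otherwise; for a nonzero row vector, the operation $(\cdot)^{-}$ is defined in the same way and gives a column vector. $\bm{I}$ is the identity matrix ($\mathbb{1}$ on the diagonal, $\mathbb{0}$ elsewhere), $\bm{A}^{0}=\bm{I}$, $\bm{A}^{p}=\bm{A}^{p-1}\bm{A}$.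 For $\bm{A}=(a_{ij})\in\mathbb{X}^{n\times n}$: $\mathrm{tr}\,\bm{A}=\bigoplus_{k=1}^{n}a_{kk}$, $\mathrm{Tr}(\bm{A})=\bigoplus_{k=1}^{n}\mathrm{tr}\,\bm{A}^{k}$, and $\bm{A}^{\ast}=\bigoplus_{k=0}^{n-1}\bm{A}^{k}$ (Kleene star, used when $\mathrm{Tr}(\bm{A})\leq\mathbb{1}$). In sums over $0\leq i+j\leq n-2$, the indices $i,j$ are nonnegative integers; an empty sum is zero. *)

(* Defs.v *)
From HB Require Import structures.
From mathcomp Require Import all_boot all_order all_algebra.

Set Implicit Arguments.
Unset Strict Implicit.
Unset Printing Implicit Defensive.

Import GRing.Theory.

Local Open Scope ring_scope.

(* The semifield addition and multiplication are the [+] and [*] of the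
   underlying commutative nontrivial semiring, so matrix products, powers and
   traces are the library's.  The value of [sinv] at 0 is unspecified. *)
HB.mixin Record ComNzSemiRing_isIdemSemifield R
    of GRing.ComNzSemiRing R := {
  addss : forall x : R, x + x = x;
  sinv : R -> R;
  mulVs : forall x : R, x != 0 -> sinv x * x = 1
}.

#[short(type="idemSemifieldType")]
HB.structure Definition IdemSemifield :=
  { R of GRing.ComNzSemiRing R & ComNzSemiRing_isIdemSemifield R }.

Definition sle (X : idemSemifieldType) (x y : X) : Prop := x + y = y.
Definition slt (X : idemSemifieldType) (x y : X) : Prop := sle x y /\ x <> y.

Definition linearly_ordered (X : idemSemifieldType) : Prop :=
  forall x y : X, sle x y \/ sle y x.

Definition radicable (X : idemSemifieldType) : Prop :=
  forall (a : X) (p : nat), (0 < p)%N -> exists! x : X, x ^+ p = a.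

Definition mxle (X : idemSemifieldType) (m n : nat) (A B : 'M[X]_(m, n)) : Prop :=
  forall i j, sle (A i j) (B i j).

Definition regular (X : idemSemifieldType) (n : nat) (x : 'cV[X]_n) : Prop :=
  forall i, x i ord0 <> 0.

(* The operation (.)^-, taking columns to rows and rows to columns. *)
Definition mulconj (X : idemSemifieldType) (m n : nat) (A : 'M[X]_(m, n)) :
    'M[X]_(n, m) :=
  \matrix_(i, j) (if A j i == 0 then 0 else sinv (A j i)).

(* Identification of 1 x 1 matrices with scalars. *)
Definition scal (X : idemSemifieldType) (A : 'M[X]_1) : X := A ord0 ord0.

Definition Trace (X : idemSemifieldType) (n : nat) (A : 'M[X]_n) : X :=
  \sum_(1 <= k < n.+1) \tr (A ^+ k).

Definition star (X : idemSemifieldType) (n : nat) (A : 'M[X]_n) : 'M[X]_n :=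
  \sum_(0 <= k < n) A ^+ k.

Definition objective (X : idemSemifieldType) (n : nat)
    (p q x : 'cV[X]_n) : X :=
  scal (mulconj x *m p *m mulconj q *m x).

Definition feasible (X : idemSemifieldType) (n : nat) (B : 'M[X]_n)
    (g h x : 'cV[X]_n) : Prop :=
  [/\ regular x, mxle (B *m x) x, mxle g x & mxle x h].

Definition is_minimum (X : idemSemifieldType) (T : Type) (S : T -> Prop)
    (f : T -> X) (m : X) : Prop :=
  (exists2 x, S x & f x = m) /\ (forall x, S x -> sle m (f x)).

(* The range 0 <= i + j <= n - 2 is written i + j + 2 <= n, because truncated
   subtraction would make it nonempty for n = 1. *)
Definition theta (X : idemSemifieldType) (n : nat) (B : 'M[X]_n)
    (g h p q : 'cV[X]_n) : X :=
  \sum_(i < n) \sum_(j < n | (i + j + 2 <= n)%N)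
     scal (mulconj h *m B ^+ i *m p) * scal (mulconj q *m B ^+ j *m g)
  + scal (mulconj q *m star B *m p).

Definition Gmx (X : idemSemifieldType) (n : nat) (B : 'M[X]_n)
    (g h p q : 'cV[X]_n) : 'M[X]_n :=
  \sum_(i < n) \sum_(j < n | (i + j + 2 <= n)%N)
     sinv (theta B g h p q) *: (B ^+ i *m p *m mulconj q *m B ^+ j)
  + star B.

(* Main.v *)
Require Import Defs.
From HB Require Import structures.
From Corelib Require Import Setoid.
From mathcomp Require Import all_boot all_order all_algebra.

(** For regular [x], the bound [x^- p q^- x <= t] says [t^-1 p q^- x <= x].
    Hence the points of the feasible set with objective at most [theta] are the
    solutions of [C x <= x], [g <= x <= h] with [C = theta^-1 p q^- + B], and
    these are the [S u] with [g <= u <= (h^- S)^-], [S] the Kleene star of [C],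
    as soon as [Tr C <= 1].  Since [q^- B^i p <= theta], a word in [A = theta^-1 p q^-]
    and [B] with several letters [A] is dominated by one with a single [A];
    this gives both [Tr C <= 1] and [S = G].  Conversely, any value [t] of
    the objective dominates every term of [theta]: apply [B^i] and pair with
    [h^-] or [q^-] in [p (q^- x) <= t x]. *)

Set Implicit Arguments.
Unset Strict Implicit.
Unset Printing Implicit Defensive.

Import GRing.Theory.

Local Open Scope ring_scope.

Section Order.
Variable X : idemSemifieldType.
Implicit Types a b c d s t : X.

Lemma sle_refl a : sle a a.
Proof. exact: addss. Qed.

Lemma sle_trans b a c : sle a b -> sle b c -> sle a c.
Proof. by rewrite /sle => ab <-; rewrite addrA ab. Qed.

Lemma sle_antisym a b : sle a b -> sle b a -> a = b.
Proof. by rewrite /sle => ab ba; rewrite -[LHS]ba addrC. Qed.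

Lemma sle0x a : sle 0 a.
Proof. exact: add0r. Qed.

Lemma slex0 a : sle a 0 -> a = 0.
Proof. by rewrite /sle addr0. Qed.

Lemma sle_addl a b : sle a (a + b).
Proof. by rewrite /sle addrA addss. Qed.

Lemma sle_addr a b : sle b (a + b).
Proof. by rewrite addrC; apply: sle_addl. Qed.

Lemma sle_add_lub a b c : sle a c -> sle b c -> sle (a + b) c.
Proof. by rewrite /sle => ac bc; rewrite -addrA bc ac. Qed.

Lemma sle_mul a b c d : sle a b -> sle c d -> sle (a * c) (b * d).
Proof.
rewrite /sle => <- <-.
rewrite mulrDl !mulrDr !addrA addss //.
Qed.

Lemma sle_sum_lub (I : eqType) (r : seq I) (P : pred I) (F : I -> X) c :
  (forall i, i \in r -> P i -> sle (F i) c) -> sle (\sum_(i <- r | P i) F i) c.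
Proof.
move=> Fc; rewrite big_seq_cond.
elim/big_ind: _ => [|a b|i /andP[]]; first exact: sle0x.
- exact: sle_add_lub.
- exact: Fc.
Qed.

Lemma sle_sum_sup (I : eqType) (r : seq I) (P : pred I) (F : I -> X) i :
  i \in r -> P i -> sle (F i) (\sum_(j <- r | P j) F j).
Proof.
elim: r => // k r IH; rewrite inE big_cons => /predU1P[<- -> | ir Pi].
  exact: sle_addl.
by case: ifP => _; [apply: sle_trans (sle_addr _ _)|]; apply: IH.
Qed.

Lemma sle_sum_fin (I : finType) (P : pred I) (F : I -> X) i :
  P i -> sle (F i) (\sum_(j | P j) F j).
Proof. by apply: sle_sum_sup; rewrite mem_index_enum. Qed.

Lemma mulsV a : a != 0 -> a * sinv a = 1.
Proof. by move=> a0; rewrite mulrC mulVs. Qed.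

Lemma smul_neq0 a b : a != 0 -> b != 0 -> a * b != 0.
Proof.
move=> a0; apply: contra_neq => ab0.
by rewrite -[b]mul1r -(mulVs _ a0) -mulrA ab0 mulr0.
Qed.

Lemma sinv_neq0 a : a != 0 -> sinv a != 0.
Proof.
move=> a0; apply/eqP => ia0.
by have := mulVs _ a0; rewrite ia0 mul0r => /esym/eqP; rewrite oner_eq0.
Qed.

Lemma sle_pmul2l s a b : s != 0 -> sle (s * a) (s * b) -> sle a b.
Proof.
move=> s0 /(sle_mul (sle_refl (sinv s))).
by rewrite !mulrA mulVs // !mul1r.
Qed.

Lemma sle_divl s a t : s != 0 -> sle (sinv s * a) t <-> sle a (t * s).
Proof.
move=> s0; split=> [|ats].
  by move=> /(sle_mul (sle_refl s)); rewrite mulrA mulsV // mul1r mulrC.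
by apply: (sle_pmul2l s0); rewrite mulrA mulsV // mul1r mulrC.
Qed.

End Order.

Section MatrixOrder.
Variable X : idemSemifieldType.
Implicit Types m n k : nat.

Lemma mxle_refl m n (A : 'M[X]_(m, n)) : mxle A A.
Proof. by move=> i j; apply: sle_refl. Qed.

Lemma mxle_trans m n (B A C : 'M[X]_(m, n)) :
  mxle A B -> mxle B C -> mxle A C.
Proof. by move=> AB BC i j; apply: sle_trans (AB i j) (BC i j). Qed.

Lemma mxle_antisym m n (A B : 'M[X]_(m, n)) : mxle A B -> mxle B A -> A = B.
Proof. by move=> AB BA; apply/matrixP=> i j; apply: sle_antisym. Qed.

Lemma mxle_addl m n (A B : 'M[X]_(m, n)) : mxle A (A + B).
Proof. by move=> i j; rewrite mxE; apply: sle_addl. Qed.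

Lemma mxle_addr m n (A B : 'M[X]_(m, n)) : mxle B (A + B).
Proof. by rewrite addrC; apply: mxle_addl. Qed.

Lemma mxle_add_lub m n (A B C : 'M[X]_(m, n)) :
  mxle A C -> mxle B C -> mxle (A + B) C.
Proof. by move=> AC BC i j; rewrite mxE; apply: sle_add_lub. Qed.

Lemma mxle_sum_lub m n (I : eqType) (r : seq I) (P : pred I)
    (F : I -> 'M[X]_(m, n)) C :
  (forall i, i \in r -> P i -> mxle (F i) C) ->
  mxle (\sum_(i <- r | P i) F i) C.
Proof.
by move=> FC i j; rewrite summxE; apply: sle_sum_lub => k kr Pk; apply: FC.
Qed.

Lemma mxle_sum_sup m n (I : eqType) (r : seq I) (P : pred I)
    (F : I -> 'M[X]_(m, n)) i :
  i \in r -> P i -> mxle (F i) (\sum_(j <- r | P j) F j).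
Proof.
move=> ir Pi k l; rewrite summxE.
exact: (@sle_sum_sup _ _ _ _ (fun j => F j k l)).
Qed.

Lemma mxle_mul m n k (A B : 'M[X]_(m, n)) (C D : 'M[X]_(n, k)) :
  mxle A B -> mxle C D -> mxle (A *m C) (B *m D).
Proof.
move=> AB CD i j; rewrite !mxE; apply: sle_sum_lub => l _ _.
apply: sle_trans (sle_mul (AB i l) (CD l j)) _.
exact: (@sle_sum_fin _ _ predT (fun l => B i l * D l j)).
Qed.

Lemma mxle_mull m n k (A : 'M[X]_(m, n)) (C D : 'M[X]_(n, k)) :
  mxle C D -> mxle (A *m C) (A *m D).
Proof. by move=> CD; apply: mxle_mul => //; apply: mxle_refl. Qed.

Lemma mxle_mulr m n k (A B : 'M[X]_(m, n)) (C : 'M[X]_(n, k)) :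
  mxle A B -> mxle (A *m C) (B *m C).
Proof. by move=> AB; apply: mxle_mul => //; apply: mxle_refl. Qed.

Lemma mxle_scale m n s t (A B : 'M[X]_(m, n)) :
  sle s t -> mxle A B -> mxle (s *: A) (t *: B).
Proof. by move=> st AB i j; rewrite !mxE; apply: sle_mul. Qed.

Lemma mxle_exp n k (A B : 'M[X]_n) : mxle A B -> mxle (A ^+ k) (B ^+ k).
Proof.
move=> AB; elim: k => [|k IH]; first exact: mxle_refl.
by rewrite !exprS; apply: mxle_mul.
Qed.

Lemma exp_mul_le n k (A : 'M[X]_n) (x : 'cV[X]_n) :
  mxle (A *m x) x -> mxle (A ^+ k *m x) x.
Proof.
move=> Ax; elim: k => [|k IH]; first by rewrite expr0 -idmxE mul1mx; apply: mxle_refl.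
rewrite exprSr -mulmxE -mulmxA.
exact: mxle_trans (mxle_mull _ Ax) IH.
Qed.

Lemma sle_trace n (A B : 'M[X]_n) : mxle A B -> sle (\tr A) (\tr B).
Proof.
move=> AB; rewrite /mxtrace; apply: sle_sum_lub => i _ _.
apply: sle_trans (AB i i) _.
exact: (@sle_sum_fin _ _ predT (fun i => B i i)).
Qed.

Lemma scalZ t (A : 'M[X]_1) : scal (t *: A) = t * scal A.
Proof. by rewrite /scal mxE. Qed.

Lemma mulmx_scal m (A : 'cV[X]_m) (M : 'M[X]_1) : A *m M = scal M *: A.
Proof. by rewrite {1}[M]mx11_scalar mul_mx_scalar. Qed.

Lemma exp_le_star n k (A : 'M[X]_n) : (k < n)%N -> mxle (A ^+ k) (star A).
Proof.
by move=> kn; apply: mxle_sum_sup => //; rewrite mem_index_iota.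
Qed.

Lemma residuation_col n (h y : 'cV[X]_n) t :
  regular h -> sle (scal (mulconj h *m y)) t <-> mxle y (t *: h).
Proof.
move=> hreg; have h0 i : h i ord0 != 0 by apply/eqP.
rewrite /scal mxE; split=> [le_t i j | le_y].
  rewrite (ord1 j) mxE -sle_divl //; apply: sle_trans le_t.
  have := @sle_sum_fin _ _ predT
            (fun i => mulconj h ord0 i * y i ord0) i isT.
  by rewrite mxE (negPf (h0 i)).
apply: sle_sum_lub => i _ _; rewrite mxE (negPf (h0 i)) sle_divl //.
by have := le_y i ord0; rewrite mxE.
Qed.

Lemma residuation_row n (r : 'rV[X]_n) (u : 'cV[X]_n) :
  (forall i, r ord0 i != 0) ->
  sle (scal (r *m u)) 1 <-> mxle u (mulconj r).
Proof.
move=> r0; rewrite /scal mxE; split=> [le1 i j | le_u].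
  rewrite (ord1 j) mxE (negPf (r0 i)); apply: (sle_pmul2l (r0 i)).
  rewrite mulsV //; apply: sle_trans le1.
  exact: (@sle_sum_fin _ _ predT (fun i => r ord0 i * u i ord0)).
apply: sle_sum_lub => i _ _.
have := sle_mul (sle_refl (r ord0 i)) (le_u i ord0).
by rewrite mxE (negPf (r0 i)) mulsV.
Qed.

Lemma objective_le n (p q x : 'cV[X]_n) t : regular x ->
  sle (objective p q x) t <-> mxle (p *m mulconj q *m x) (t *: x).
Proof. by move=> xreg; rewrite -residuation_col // /objective !mulmxA. Qed.

End MatrixOrder.

(** * Carré's inequality: powers are below the Kleene star when [Tr C <= 1] *)

Section Paths.
Variables (X : idemSemifieldType) (n : nat) (C : 'M[X]_n).
Implicit Types (i j : 'I_n) (s : seq 'I_n).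

Fixpoint weight i s : X := if s is k :: s' then C i k * weight k s' else 1.

Lemma weight_cat i s1 s2 :
  weight i (s1 ++ s2) = weight i s1 * weight (last i s1) s2.
Proof. by elim: s1 i => [|k s1 IH] i /=; rewrite ?mul1r // IH mulrA. Qed.

Lemma weight_le_exp i s : sle (weight i s) ((C ^+ size s) i (last i s)).
Proof.
elim: s i => [|k s IH] i /=.
  by rewrite expr0 -idmxE mxE eqxx; apply: sle_refl.
rewrite exprS -mulmxE mxE.
apply: sle_trans (sle_mul (sle_refl _) (IH k)) _.
exact: (@sle_sum_fin _ _ predT (fun l => C i l * (C ^+ size s) l (last k s))).
Qed.

Lemma exp_le_of_weight k a i j c :
  (forall s, size s = k -> last i s = j -> sle (a * weight i s) c) ->
  sle (a * (C ^+ k) i j) c.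
Proof.
elim: k a i => [|k IH] a i le_c.
  rewrite expr0 -idmxE mxE; case: eqP => [ij|_]; last first.
    by rewrite mulr0n mulr0; apply: sle0x.
  exact: (le_c [::]).
rewrite exprS -mulmxE mxE mulr_sumr; apply: sle_sum_lub => l _ _.
rewrite mulrA; apply: IH => s sk sj; rewrite -mulrA.
by apply: (le_c (l :: s)); rewrite /= ?sk.
Qed.

Lemma path_cycle i s : (n <= size s)%N ->
  exists s1 s2 s3, [/\ s = s1 ++ s2 ++ s3, (0 < size s2 <= n)%N &
                       last (last i s1) s2 = last i s1].
Proof.
move=> ns; have : ~~ uniq (i :: take n s).
  apply/negP => /card_uniqP /= E.
  by have := max_card (mem (i :: take n s)); rewrite E card_ord size_takel ?ltnn.
case/(uniqPn i) => a [b [ab]].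
rewrite /= size_takel // ltnS => bn nth_ab.
have last_take c : (c <= n)%N ->
    last i (take c s) = nth i (i :: take n s) c.
  move=> cn; rewrite (last_nth i) size_takel ?(leq_trans cn) //.
  by case: c cn => //= c cn; rewrite !nth_take.
have bE : (a + (b - a) = b)%N by rewrite subnKC // ltnW.
exists (take a s), (take (b - a) (drop a s)), (drop (b - a) (drop a s)).
split; first by rewrite !cat_take_drop.
  rewrite size_takel; first by rewrite subn_gt0 ab (leq_trans (leq_subr _ _)).
  by rewrite size_drop leq_sub2r // (leq_trans bn).
rewrite -last_cat -takeD bE !last_take ?nth_ab //.
by rewrite (leq_trans (ltnW ab)).
Qed.

Hypothesis TrC : sle (Trace C) 1.

Lemma weight_cycle i s :
  (0 < size s <= n)%N -> last i s = i -> sle (weight i s) 1.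
Proof.
move=> sn si; have := weight_le_exp i s; rewrite si => le_ii.
apply: sle_trans le_ii (sle_trans _ TrC).
apply: (@sle_trans _ (\tr (C ^+ size s))).
  exact: (@sle_sum_fin _ _ predT (fun i => (C ^+ size s) i i)).
apply: (@sle_sum_sup _ _ _ _ (fun k => \tr (C ^+ k))) => //.
by rewrite mem_index_iota ltnS.
Qed.

Lemma weight_le_star i s : sle (weight i s) (star C i (last i s)).
Proof.
have [m] := ubnP (size s); elim: m s => // m IH s.
have [sn _ | ns] := ltnP (size s) n.
  exact: sle_trans (weight_le_exp i s) (exp_le_star C sn i _).
have [s1 [s2 [s3 [-> s2n cyc]]]] := path_cycle i ns.
rewrite !size_cat ltnS => sm.
have s13 : (size (s1 ++ s3) < m)%N.
  rewrite (leq_trans _ sm) // size_cat ltn_add2l.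
  by case/andP: s2n => s2_gt0 _; rewrite -[ltnLHS]add0n ltn_add2r.
have := IH _ s13; rewrite !last_cat cyc => le_star; apply: sle_trans le_star.
rewrite !weight_cat cyc; apply: sle_mul; first exact: sle_refl.
rewrite -[X in sle _ X]mul1r; apply: sle_mul; last exact: sle_refl.
exact: weight_cycle.
Qed.

Lemma exp_le_star_all k : mxle (C ^+ k) (star C).
Proof.
move=> i j; rewrite -[_ i j]mul1r; apply: exp_le_of_weight => s _ <-.
by rewrite mul1r; apply: weight_le_star.
Qed.

Lemma mul_star_le : mxle (C *m star C) (star C).
Proof.
rewrite /star mulmx_sumr; apply: mxle_sum_lub => k _ _.
by rewrite mulmxE -exprS; apply: exp_le_star_all.
Qed.

End Paths.

(** * Words in two matrices *)

Section Words.
Variables (X : idemSemifieldType) (n : nat) (A B : 'M[X]_n).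

(* The words of length [< m] in [A] and [B] with at most one letter [A]. *)
Definition words m : 'M[X]_n :=
  \sum_(i < m) \sum_(j < m | (i + j + 2 <= m)%N) B ^+ i *m A *m B ^+ j
  + \sum_(0 <= k < m) B ^+ k.

Lemma word_le_words m i j : (i + j + 2 <= m)%N ->
  mxle (B ^+ i *m A *m B ^+ j) (words m).
Proof.
move=> ijm; have im : (i < m)%N.
  by apply: leq_trans ijm; rewrite addn2 ltnS leqW // leq_addr.
have jm : (j < m)%N.
  by apply: leq_trans ijm; rewrite addn2 ltnS leqW // leq_addl.
apply: mxle_trans (mxle_addl _ _).
pose F (i j : 'I_m) : 'M[X]_n := B ^+ i *m A *m B ^+ j.
apply: mxle_trans
  (@mxle_sum_sup _ _ _ _ (index_enum 'I_m) predT
    (fun i : 'I_m => \sum_(j < m | (i + j + 2 <= m)%N) F i j)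
    (Ordinal im) (mem_index_enum _) isT).
exact: (@mxle_sum_sup _ _ _ _ (index_enum 'I_m)
  (fun j : 'I_m => (i + j + 2 <= m)%N) (F (Ordinal im)) (Ordinal jm)
  (mem_index_enum _)).
Qed.

Lemma exp_le_words m k : (k < m)%N -> mxle (B ^+ k) (words m).
Proof.
move=> km; apply: mxle_trans (mxle_addr _ _).
by apply: mxle_sum_sup => //; rewrite mem_index_iota.
Qed.

Hypothesis ABA : forall i, mxle (A *m B ^+ i *m A) A.

(* The prefix [L] makes the induction on [k] go through. *)
Lemma mul_exp_add_le k (L M : 'M[X]_n) :
  (forall l, (l <= k)%N -> mxle (L *m B ^+ l) M) ->
  (forall i j, (i + j < k)%N -> mxle (L *m (B ^+ i *m A *m B ^+ j)) M) ->
  mxle (L *m (A + B) ^+ k) M.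
Proof.
elim: k L => [|k IH] L LB LBAB.
  by have := LB 0 isT; rewrite !expr0.
rewrite exprS -mulmxE mulmxA mulmxDr mulmxDl; apply: mxle_add_lub.
- apply: IH => [l lk | i j ijk].
    by have := LBAB 0 l lk; rewrite expr0 -idmxE mul1mx !mulmxA.
  apply: (@mxle_trans _ _ _ (L *m (A *m B ^+ j))).
    rewrite -(mulmxA L); apply: mxle_mull; rewrite !mulmxA; apply: mxle_mulr.
    exact: ABA.
  have := LBAB 0 j; rewrite expr0 -idmxE mul1mx; apply.
  by rewrite ltnS (leq_trans (leq_addl i j)) // ltnW.
- apply: IH => [l lk | i j ijk].
    by have := LB l.+1 lk; rewrite exprS -mulmxE mulmxA.
  by have := LBAB i.+1 j; rewrite exprS -mulmxE !mulmxA; apply.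
Qed.

Lemma exp_add_le_words m k : (k < m)%N -> mxle ((A + B) ^+ k) (words m).
Proof.
move=> km; rewrite -[_ ^+ k]mul1mx; apply: mul_exp_add_le => [l lk | i j ijk].
  by rewrite mul1mx; apply: exp_le_words; apply: leq_ltn_trans km.
rewrite mul1mx; apply: word_le_words; rewrite addn2.
exact: leq_ltn_trans ijk km.
Qed.

Lemma star_add : star (A + B) = words n.
Proof.
apply: mxle_antisym.
  apply: mxle_sum_lub => k; rewrite mem_index_iota => /andP[_ kn] _.
  exact: exp_add_le_words.
have AC : mxle A (A + B) by apply: mxle_addl.
have BC : mxle B (A + B) by apply: mxle_addr.
apply: mxle_add_lub.
  apply: mxle_sum_lub => i _ _; apply: mxle_sum_lub => j _ ijn.
  apply: (@mxle_trans _ _ _ ((A + B) ^+ (i + 1 + j))); last first.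
    by apply: exp_le_star; rewrite addn1 addSn -addn2.
  rewrite !exprD expr1 -!mulmxE.
  by do 2?apply: mxle_mul => //; apply: mxle_exp.
apply: mxle_sum_lub => k; rewrite mem_index_iota => /andP[_ kn] _.
exact: mxle_trans (mxle_exp k BC) (exp_le_star _ kn).
Qed.

Lemma Trace_add_le :
  sle (Trace B) 1 ->
  (forall i j, sle (\tr (B ^+ i *m A *m B ^+ j)) 1) ->
  sle (Trace (A + B)) 1.
Proof.
move=> TrB trBAB; apply: sle_sum_lub => k; rewrite mem_index_iota => /andP[_ kn] _.
apply: sle_trans (sle_trace (exp_add_le_words kn)) _.
rewrite /words raddfD /= !raddf_sum /=; apply: sle_add_lub.
  apply: sle_sum_lub => i _ _; rewrite raddf_sum.
  by apply: sle_sum_lub => j _ _; apply: trBAB.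
apply: sle_sum_lub => l; rewrite mem_index_iota => /andP[_ ln] _.
case: l ln => [_ | l ln].
  apply: sle_sum_lub => i _ _.
  by rewrite expr0 -idmxE mxE eqxx; apply: sle_refl.
apply: sle_trans TrB.
apply: (@sle_sum_sup _ _ _ _ (fun k => \tr (B ^+ k))) => //.
by rewrite mem_index_iota.
Qed.

End Words.

Section Problem.
Variables (X : idemSemifieldType) (n : nat).
Variables (B : 'M[X]_n) (g h p q : 'cV[X]_n).

Lemma theta_le_objective x : regular h -> q <> 0 ->
  feasible B g h x -> sle (theta B g h p q) (objective p q x).
Proof.
move=> h_reg q_neq0 [x_reg Bx gx xh]; set t := objective p q x.
set s := scal (mulconj q *m x).
have spx : mxle (s *: p) (t *: x).
  by rewrite -mulmx_scal mulmxA -objective_le //; apply: sle_refl.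
have Bkx k : mxle (B ^+ k *m x) x by apply: exp_mul_le.
have s0 : s != 0.
  have [k qk0] : exists k, q k ord0 != 0.
    apply/existsP; rewrite -negb_forall; apply/negP => /forallP q0.
    by apply: q_neq0; apply/matrixP=> i j; rewrite (ord1 j) mxE; apply/eqP.
  have qxk : mulconj q ord0 k * x k ord0 != 0.
    by rewrite mxE (negPf qk0) smul_neq0 ?sinv_neq0 //; apply/eqP/x_reg.
  apply/eqP => s_eq0; case/eqP: qxk; apply: slex0; rewrite -s_eq0.
  rewrite /s /scal [X in sle _ X]mxE.
  exact: (@sle_sum_fin _ _ predT (fun k => mulconj q ord0 k * x k ord0)).
apply: sle_add_lub.
  apply: sle_sum_lub => i _ _; apply: sle_sum_lub => j _ _.
  apply: (@sle_trans _ (scal (mulconj h *m B ^+ i *m p) * s)).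
    apply: sle_mul; first exact: sle_refl.
    rewrite -mulmxA; apply: mxle_mull.
    exact: mxle_trans (mxle_mull _ gx) (Bkx j).
  rewrite mulrC -scalZ scalemxAr -mulmxA residuation_col //.
  apply: mxle_trans (mxle_mull _ spx) _; rewrite -scalemxAr.
  apply: mxle_scale; first exact: sle_refl.
  exact: mxle_trans (Bkx i) xh.
rewrite /star mulmx_sumr mulmx_suml /scal summxE.
apply: sle_sum_lub => k _ _; apply: (sle_pmul2l s0).
rewrite -/(scal (_ *m p)) -scalZ scalemxAr.
apply: (@sle_trans _ (scal (mulconj q *m B ^+ k *m (t *: x)))).
  exact: (mxle_mull _ spx).
rewrite -scalemxAr scalZ mulrC; apply: sle_mul; last exact: sle_refl.
by rewrite -mulmxA; apply: mxle_mull.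
Qed.

Let A : 'M[X]_n := sinv (theta B g h p q) *: (p *m mulconj q).

Lemma Gmx_words : Gmx B g h p q = words A B n.
Proof.
rewrite /Gmx /words; congr (_ + _).
apply: eq_bigr => i _; apply: eq_bigr => j _.
by rewrite /A -scalemxAr -scalemxAl !mulmxA.
Qed.

Hypotheses (TrB : sle (Trace B) 1) (theta0 : theta B g h p q != 0).

Lemma conj_exp_le_theta i :
  sle (scal (mulconj q *m B ^+ i *m p)) (theta B g h p q).
Proof.
apply: sle_trans (sle_addr _ _).
by apply: mxle_mulr; apply: mxle_mull; apply: exp_le_star_all.
Qed.

Lemma rank1_absorb i : mxle (A *m B ^+ i *m A) A.
Proof.
have -> : A *m B ^+ i *m A =
    (sinv (theta B g h p q) * scal (mulconj q *m B ^+ i *m p)) *: A.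
  rewrite /A -!scalemxAl -!scalemxAr -scalerA; congr (_ *: _).
  rewrite scalerA mulrC -scalerA; congr (_ *: _).
  by rewrite scalemxAl -mulmx_scal !mulmxA.
rewrite -[X in mxle _ X]scale1r; apply: mxle_scale; last exact: mxle_refl.
by rewrite sle_divl // mul1r; apply: conj_exp_le_theta.
Qed.

Lemma Gmx_star : Gmx B g h p q = star (A + B).
Proof. by rewrite Gmx_words star_add //; apply: rank1_absorb. Qed.

Lemma Trace_rank1_add : sle (Trace (A + B)) 1.
Proof.
apply: Trace_add_le => // [|i j]; first exact: rank1_absorb.
rewrite mxtrace_mulC mulmxA -[B ^+ j *m _]/(B ^+ j * _) -exprD /A -scalemxAr.
rewrite mxtraceZ mulmxA mxtrace_mulC mulmxA trace_mx11.
by rewrite sle_divl // mul1r; apply: conj_exp_le_theta.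
Qed.

Lemma Gmx_ge1 : (0 < n)%N -> mxle 1%:M (Gmx B g h p q).
Proof. by move=> n0; rewrite Gmx_star; apply: (exp_le_star _ n0). Qed.

Lemma rank1_add_le x : regular x ->
  mxle ((A + B) *m x) x <->
  mxle (B *m x) x /\ sle (objective p q x) (theta B g h p q).
Proof.
move=> x_reg; have Ax : mxle (A *m x) x <->
    sle (objective p q x) (theta B g h p q).
  rewrite objective_le // /A -scalemxAl; split=> le_x i j.
    by have := le_x i j; rewrite !mxE sle_divl // mulrC.
  by have := le_x i j; rewrite !mxE sle_divl // mulrC.
rewrite mulmxDl; split=> [le_x | [Bx /Ax]]; last by move=> ?; apply: mxle_add_lub.
split; first exact: mxle_trans (mxle_addr _ _) le_x.
by apply/Ax; apply: mxle_trans (mxle_addl _ _) le_x.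
Qed.

Hypotheses (n_gt0 : (0 < n)%N) (h_reg : regular h).

Lemma conj_Gmx_neq0 i : (mulconj h *m Gmx B g h p q) ord0 i != 0.
Proof.
apply/eqP => E; have := mxle_mull (mulconj h) (Gmx_ge1 n_gt0) ord0 i.
rewrite mulmx1 E mxE; case: eqP => [/h_reg // | /eqP hi] /slex0.
by apply/eqP/sinv_neq0.
Qed.

Lemma Gmx_conj_le u :
  mxle u (mulconj (mulconj h *m Gmx B g h p q)) <-> mxle (Gmx B g h p q *m u) h.
Proof.
rewrite -residuation_row; last exact: conj_Gmx_neq0.
by rewrite -mulmxA residuation_col // scale1r.
Qed.

Lemma Gmx_paramP x : regular x ->
  (exists u, [/\ u <> 0, mxle g u,
       mxle u (mulconj (mulconj h *m Gmx B g h p q)) & x = Gmx B g h p q *m u])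
  <-> feasible B g h x /\ sle (objective p q x) (theta B g h p q).
Proof.
move=> x_reg; split=> [[u [_ gu /Gmx_conj_le uh xE]] | [[_ Bx gx xh] xtheta]].
  have Cx : mxle ((A + B) *m x) x.
    rewrite xE Gmx_star mulmxA; apply: mxle_mulr.
    exact: mul_star_le Trace_rank1_add.
  have [Bx xtheta] := (rank1_add_le x_reg).1 Cx.
  split=> //; split=> //; last by rewrite xE.
  apply: mxle_trans gu _; rewrite xE -[X in mxle X]mul1mx.
  by apply: mxle_mulr; apply: Gmx_ge1.
have Gx : Gmx B g h p q *m x = x.
  apply: mxle_antisym; last first.
    by rewrite -[X in mxle X]mul1mx; apply: mxle_mulr; apply: Gmx_ge1.
  rewrite Gmx_star /star mulmx_suml; apply: mxle_sum_lub => k _ _.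
  by apply: exp_mul_le; apply/rank1_add_le.
exists x; split=> //; last by rewrite Gmx_conj_le Gx.
by move=> x0; apply: (x_reg (Ordinal n_gt0)); rewrite x0 mxE.
Qed.

Lemma Gmx_mul_le :
  sle (scal (mulconj h *m star B *m g)) 1 -> mxle (Gmx B g h p q *m g) h.
Proof.
move=> hBg; rewrite -[h in mxle _ h]scale1r -residuation_col // mulmxA.
rewrite mulmxDr mulmxDl /scal mxE; apply: sle_add_lub; last exact: hBg.
rewrite mulmx_sumr mulmx_suml summxE; apply: sle_sum_lub => i _ _.
rewrite mulmx_sumr mulmx_suml summxE; apply: sle_sum_lub => j _ ijn.
rewrite -/(scal _) -scalemxAr -scalemxAl scalZ sle_divl // mul1r.
have -> : scal (mulconj h *m (B ^+ i *m p *m mulconj q *m B ^+ j) *m g) =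
    scal (mulconj h *m B ^+ i *m p) * scal (mulconj q *m B ^+ j *m g).
  by rewrite mulrC -scalZ -mulmx_scal !mulmxA.
pose F (i j : 'I_n) :=
  scal (mulconj h *m B ^+ i *m p) * scal (mulconj q *m B ^+ j *m g).
apply: sle_trans (sle_addl _ _).
apply: sle_trans
  (@sle_sum_fin _ _ predT
    (fun i : 'I_n => \sum_(j < n | (i + j + 2 <= n)%N) F i j) i isT).
exact: (@sle_sum_fin _ _ (fun j : 'I_n => (i + j + 2 <= n)%N) (F i) j).
Qed.

Lemma Gmx_attained : sle (scal (mulconj h *m star B *m g)) 1 ->
  exists2 x, feasible B g h x & sle (objective p q x) (theta B g h p q).
Proof.
move=> hBg; set u := mulconj (mulconj h *m Gmx B g h p q).
have u0 i : u i ord0 != 0.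
  by rewrite mxE (negPf (conj_Gmx_neq0 i)) sinv_neq0 // conj_Gmx_neq0.
have Gu_reg : regular (Gmx B g h p q *m u).
  move=> i Gu0; case/eqP: (u0 i); apply: slex0; rewrite -Gu0.
  by rewrite -{1}[u]mul1mx; apply: mxle_mulr; apply: Gmx_ge1.
have [] := (Gmx_paramP Gu_reg).1; last by exists (Gmx B g h p q *m u).
exists u; split=> //; last exact: mxle_refl.
  by move=> uE; case/eqP: (u0 (Ordinal n_gt0)); rewrite uE mxE.
by apply/Gmx_conj_le; apply: Gmx_mul_le.
Qed.

End Problem.

Theorem theorem3 (X : idemSemifieldType) (n : nat)
  (B : 'M[X]_n) (g h p q : 'cV[X]_n)
  (X_lin : linearly_ordered X) (X_rad : radicable X)
  (n_ge1 : (1 <= n)%N)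
  (TrB : sle (Trace B) 1)
  (h_reg : regular h)
  (hBg : sle (scal (mulconj h *m star B *m g)) 1)
  (p_neq0 : p <> 0) (q_neq0 : q <> 0)
  (qp_gt0 : slt 0 (scal (mulconj q *m p))) :
  is_minimum (feasible B g h) (objective p q) (theta B g h p q) /\
  (forall x : 'cV[X]_n, regular x ->
     (feasible B g h x /\ objective p q x = theta B g h p q) <->
     (exists u : 'cV[X]_n,
        [/\ u <> 0,
            mxle g u,
            mxle u (mulconj (mulconj h *m Gmx B g h p q)) &
            x = Gmx B g h p q *m u])).
Proof.
have lower x : feasible B g h x -> sle (theta B g h p q) (objective p q x).
  exact: theta_le_objective.
have theta0 : theta B g h p q != 0.
  apply/eqP => theta0; case: qp_gt0 => _; apply; apply/esym/slex0.
  rewrite -theta0; have := conj_exp_le_theta g h p q TrB 0.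
  by rewrite expr0 -idmxE mulmx1.
split.
  split=> //; have [x x_feas x_le] := Gmx_attained TrB theta0 n_ge1 h_reg hBg.
  by exists x => //; apply: sle_antisym x_le (lower x x_feas).
move=> x x_reg; rewrite Gmx_paramP //; split=> [[x_feas ->] | [x_feas x_le]].
  by split=> //; apply: sle_refl.
by split=> //; apply: sle_antisym x_le (lower x x_feas).
Qed.
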